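(* (Recurrence relation for the Jacobi matrices in multiple-plane gravitational lensing.) Let $0=z_0<z_1<\dots<z_N<z_{N+1}=:z_s$ be redshifts ($N\ge1$), $\lambda_i=\lambda(z_i)$, and let $\tilde U_1,\dots,\tilde U_N$ be real symmetric $2\times2$ matrices. Let $\mathcal{D}$ be the solution of $\ddot{\mathcal{D}}=\mathcal{T}\mathcal{D}$, $\mathcal{D}(0)=0$, $\dot{\mathcal{D}}(0)=I$, with $$\mathcal{T}(\lambda)=\mathcal{R}_{\rm bg}(\lambda)\,I-\sum_{i=1}^N(1+z_i)\,\tilde U_i\,\delta(\lambda-\lambda_i),$$ i.e. $\mathcal{D}$ is continuous, satisfies $\ddot{\mathcal{D}}=\mathcal{R}_{\rm bg}\mathcal{D}$ away from the $\lambda_i$, and $\dot{\mathcal{D}}(\lambda_i^+)-\dot{\mathcal{D}}(\lambda_i^-)=-(1+z_i)\tilde U_i\mathcal{D}(\lambda_i)$. Write $\mathcal{D}_n=\mathcal{D}(\lambda_n)$. Then for $1\le n\le N$ $$\mathcal{D}_{n+1}=-D_{n,n+1}\tilde U_n\mathcal{D}_n-\frac{1+z_{n-1}}{1+z_n}\frac{D_{n,n+1}}{D_{n-1,n}}\mathcal{D}_{n-1}+\left\{\frac{1+z_{n-1}}{1+z_n}\frac{D_{n,n+1}D_{n-1}}{D_{n-1,n}D_n}+\frac{D_{n+1}}{D_n}\right\}\mathcal{D}_n .$$ Equivalently, the dimensionless matrices $A_n=\mathcal{D}_n/D_n$ ($1\le n\le N+1$) satisfy $A_1=I$ and $$A_{n+1}=(1+v_n^2)A_n-v_n^2A_{n-1}-\beta_{n,n+1}U_nA_n,\qquad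 1\le n\le N,$$ where $v_1=0$ (so that $A_0$ is irrelevant).
   Context: Dots denote $d/d\lambda$. Constants $c,H_0>0$, density parameter $\Omega\ge0$, $\tilde\alpha\in[0,1]$; affine parameter $\lambda(z)=\frac{c}{H_0}\int_0^z\frac{dz'}{(1+z')^3\sqrt{\Omega z'+1}}$; background source of convergence $\mathcal{R}_{\rm bg}=-\frac32\left(\frac{H_0}{c}\right)^2\tilde\alpha\,\Omega\,(1+z)^5$. In terms of $z$, the equation $\ddot B=\mathcal{R}_{\rm bg}B$ is the Dyer–Roeder equation $$(\Omega z+1)(1+z)B''+\left[\tfrac72\Omega z+\tfrac{\Omega}{2}+3\right]B'+\tfrac32\tilde\alpha\Omega B=0 .$$ For each $z_i$ let $r(z_i,\cdot)$ be its solution with $r(z_i,z_i)=0$ and $\frac{d}{dz}r(z_i,z)|_{z=z_i}=\frac{1}{(1+z_i)^2\sqrt{\Omega z_i+1}}$; $r(z_i,z)>0$ for $z>z_i$. The empty-cone angular diameter distances are $D_{ij}=D(z_i,z_j)=\frac{c}{H_0}|r(z_i,z_j)|$ and $D_i=D(0,z_i)$, so $D_0=0$ and $D_{0,1}=D_1$. Further definitions: $$\vartheta_i=\frac{1+z_i}{c}\frac{D_iD_{i+1}}{D_{i,i+1}}\ (0\le i\le N),\qquad v_i=-\sqrt{\vartheta_{i-1}/\vartheta_i}\ (1\le i\le N),$$ $$\beta_{ij}=\frac{D_{ij}D_{N+1}}{D_jD_{i,N+1}}\ (1\le i<j\le N+1),\qquad U_j=\frac{D_{j,N+1}D_j}{D_{N+1}}\tilde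 U_j .$$ *)

(* Defs.v *)
From HB Require Import structures.
From mathcomp Require Import all_boot all_order all_algebra.
From mathcomp Require Import all_classical all_reals all_analysis.

Set Implicit Arguments.
Unset Strict Implicit.
Unset Printing Implicit Defensive.

Import Order.TTheory GRing.Theory Num.Theory.
Import numFieldNormedType.Exports.

Local Open Scope classical_set_scope.
Local Open Scope ring_scope.

(* One-sided, because the redshift and the affine parameter both start at 0,
   where initial conditions are imposed. At a point where f is differentiable
   this is the ordinary derivative. *)
Definition has_right_derivative (R : realType) (V : normedModType R)
    (f : R -> V) (a : R) (l : V) : Prop :=
  (h^-1 *: (f (a + h) - f a)) @[h --> 0^'+] --> l.

Definition affine_parameter (R : realType) (c H0 Omega z : R) : R :=
  c / H0 * \int[lebesgue_measure]_(x in `[0, z])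
             ((1 + x) ^+ 3 * Num.sqrt (Omega * x + 1))^-1.

(* R_bg at the point of affine parameter lambda(z), as a function of z. *)
Definition convergence_bg (R : realType) (c H0 Omega alpha z : R) : R :=
  - (3 / 2) * (H0 / c) ^+ 2 * alpha * Omega * (1 + z) ^+ 5.

(* B solves the Dyer-Roeder equation on [0, +oo[; the coefficients being
   regular at 0, continuity there determines the behaviour at the endpoint. *)
Definition dyer_roeder (R : realType) (Omega alpha : R) (B : R -> R) : Prop :=
  {within `[0, +oo[, continuous B} /\
  forall z : R, 0 < z ->
    [/\ derivable B z 1, derivable (derive1 B) z 1 &
        (Omega * z + 1) * (1 + z) * derive1 (derive1 B) z
        + (7 / 2 * Omega * z + Omega / 2 + 3) * derive1 B z
        + 3 / 2 * alpha * Omega * B z = 0].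

(* r zi is the function of redshift r(z_i, .). *)
Definition dyer_roeder_from (R : realType) (Omega alpha : R)
    (r : R -> R -> R) (zi : R) : Prop :=
  [/\ dyer_roeder Omega alpha (r zi),
      r zi zi = 0 &
      has_right_derivative (r zi) zi
        ((1 + zi) ^+ 2 * Num.sqrt (Omega * zi + 1))^-1].

Definition angular_distance (R : realType) (c H0 : R) (r : R -> R -> R)
    (zi zj : R) : R :=
  c / H0 * `|r zi zj|.

(* Below, D i j stands for D_{ij}, and D 0 i for D_i. *)

Definition vartheta (R : realType) (c : R) (z : nat -> R)
    (D : nat -> nat -> R) (i : nat) : R :=
  (1 + z i) / c * (D 0%N i * D 0%N i.+1 / D i i.+1).

Definition lens_v (R : realType) (c : R) (z : nat -> R)
    (D : nat -> nat -> R) (i : nat) : R :=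
  - Num.sqrt (vartheta c z D i.-1 / vartheta c z D i).

Definition lens_beta (R : realType) (N : nat) (D : nat -> nat -> R)
    (i j : nat) : R :=
  D i j * D 0%N N.+1 / (D 0%N j * D i N.+1).

Definition lens_U (R : realType) (N : nat) (D : nat -> nat -> R)
    (Ut : nat -> 'M[R]_2) (j : nat) : 'M[R]_2 :=
  (D j N.+1 * D 0%N j / D 0%N N.+1) *: Ut j.

(* J solves J'' = T J, J(0) = 0, J'(0) = I on [0, lambda_{N+1}], where T is
   R_bg I minus the Dirac terms (1 + z_i) Ut_i at lambda_i, 1 <= i <= N.
   The points of ]lambda_i, lambda_{i+1}[ are written lambda(x) with
   z_i < x < z_{i+1}; Jm and Jp are the one-sided limits of J' at lambda_i. *)
Definition jacobi_solution (R : realType) (c H0 Omega alpha : R) (N : nat)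
    (z : nat -> R) (Ut : nat -> 'M[R]_2) (J : R -> 'M[R]_2) : Prop :=
  let lambda := affine_parameter c H0 Omega in
  [/\ {within `[0, lambda (z N.+1)], continuous J},
      J 0 = 0,
      has_right_derivative J 0 1%:M,
      forall (i : nat) (x : R), (i <= N)%N -> z i < x < z i.+1 ->
        [/\ derivable J (lambda x) 1, derivable (derive1 J) (lambda x) 1 &
            derive1 (derive1 J) (lambda x) =
              convergence_bg c H0 Omega alpha x *: J (lambda x)] &
      forall i : nat, (1 <= i <= N)%N ->
        exists Jm Jp : 'M[R]_2,
          [/\ derive1 J x @[x --> (lambda (z i))^'-] --> Jm,
              derive1 J x @[x --> (lambda (z i))^'+] --> Jp &
              Jp - Jm = - ((1 + z i) *: (Ut i *m J (lambda (z i))))]].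

(* Main.v *)
Require Import Defs.
From HB Require Import structures.
From mathcomp Require Import all_boot all_order all_algebra.
From mathcomp Require Import all_classical all_reals all_analysis.
From mathcomp Require Import ring lra.

Set Implicit Arguments.
Unset Strict Implicit.
Unset Printing Implicit Defensive.

Import Order.TTheory GRing.Theory Num.Theory.
Import numFieldNormedType.Exports.

Local Open Scope classical_set_scope.
Local Open Scope ring_scope.

(** Written in the redshift, the equation [B'' = R_bg B] is a first-order system
[f' = phi F, F' = rho f], where [F] is the derivative with respect to the affine
parameter; both the distances [r (z_i)] and the entries of the Jacobi matrix
solve it between two lens planes, so their pairwise Wronskians [W] are constant
there. Between the planes [i] and [i+1], comparing an entry [y] and
[d = r (z_0)] with [r (z_i)], which vanishes at [z_i], gives
[r_{i,i+1} W(d,y) = (1 + z_i) H0 / c (y_{i+1} d_i - d_{i+1} y_i)].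
Crossing the plane [n] changes [W(d,y)] by [d_n] times the jump of the derivative
of [y]; eliminating [W(d,y)] from the two adjacent segments is the recurrence.
The distances are positive because [sqrt (Omega z + 1) / (1 + z)^2] is a positive
solution for [alpha = 1], which Picone's identity compares with [r (z_i)]. *)

(** * Calculus on open intervals: mean value arguments, one-sided limits, Wronskians *)

Section calculus.
Context {R : realType}.
Implicit Types (f g F : R -> R) (a b x : R).

Lemma near_at_rightP a b (P : R -> Prop) : a < b ->
  (forall x, a < x < b -> P x) -> \forall x \near a^'+, P x.
Proof.
move=> ab H; near=> x; apply: H; apply/andP; split; first by [].
near: x; exact: nbhs_right_lt.
Unshelve. all: by end_near. Qed.

Lemma near_at_leftP a b (P : R -> Prop) : a < b ->
  (forall x, a < x < b -> P x) -> \forall x \near b^'-, P x.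
Proof.
move=> ab H; near=> x; apply: H; apply/andP; split; last by [].
near: x; exact: nbhs_left_gt.
Unshelve. all: by end_near. Qed.

Lemma is_derive_continuous f x l : is_derive x 1 f l -> {for x, continuous f}.
Proof.
by move=> [df _]; apply: differentiable_continuous; apply/derivable1_diffP.
Qed.

Lemma MVT_oo f F a b : (forall x, a < x < b -> is_derive x 1 f (F x)) ->
  forall x y, a < x -> x < y -> y < b ->
    exists2 t, x < t < y & f y - f x = F t * (y - x).
Proof.
move=> fF x y ax xy yb; have [t||t txy E] := @MVT R f F x y xy.
- rewrite in_itv/= => /andP[xt ty]; apply: fF.
  by rewrite (lt_trans ax xt) (lt_trans ty yb).
- apply: derivable_within_continuous => t; rewrite in_itv/= => /andP[xt ty].
  have : a < t < b by rewrite (lt_le_trans ax xt) (le_lt_trans ty yb).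
  by move=> /fF [].
- by exists t => //; move: txy; rewrite in_itv.
Qed.

Lemma constant_oo f a b : (forall x, a < x < b -> is_derive x 1 f 0) ->
  forall x y, a < x < b -> a < y < b -> f x = f y.
Proof.
move=> f0.
have lt_cst x y : a < x -> x < y -> y < b -> f x = f y.
  move=> ax xy yb; have [t _] := MVT_oo f0 ax xy yb.
  by rewrite mul0r => /eqP; rewrite subr_eq0 => /eqP.
move=> x y /andP[ax xb] /andP[ay yb].
by have [xy|yx|->//] := ltgtP x y; [|symmetry]; apply: lt_cst.
Qed.

Lemma nondecreasing_oo f F a b :
  (forall x, a < x < b -> is_derive x 1 f (F x)) ->
  (forall x, a < x < b -> 0 <= F x) ->
  forall x y, a < x -> x <= y -> y < b -> f x <= f y.
Proof.
move=> fF F0 x y ax; rewrite le_eqVlt => /predU1P[->//|xy] yb.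
have [t /andP[xt ty] E] := MVT_oo fF ax xy yb.
rewrite -subr_ge0 E mulr_ge0 ?subr_ge0 ?(ltW xy)// F0//.
by rewrite (lt_trans ax xt) (lt_trans ty yb).
Qed.

Lemma eq_at_right_lim f a b l : a < b ->
  (forall x y, a < x < b -> a < y < b -> f x = f y) ->
  f x @[x --> a^'+] --> l -> forall x, a < x < b -> f x = l.
Proof.
move=> ab fcst fl x xab.
have H : f y @[y --> a^'+] --> f x.
  apply: cvg_near_cst; apply: near_at_rightP ab _ => y yab; exact: fcst.
exact: (cvg_unique _ H fl).
Qed.

Lemma eq_at_left_lim f a b l : a < b ->
  (forall x y, a < x < b -> a < y < b -> f x = f y) ->
  f x @[x --> b^'-] --> l -> forall x, a < x < b -> f x = l.
Proof.
move=> ab fcst fl x xab.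
have H : f y @[y --> b^'-] --> f x.
  apply: cvg_near_cst; apply: near_at_leftP ab _ => y yab; exact: fcst.
exact: (cvg_unique _ H fl).
Qed.

(* [F] is bounded near [a] by the mean value theorem. *)
Lemma cvg_mul_derive_bounded F k g a b (l : R) : a < b ->
  (forall x, a < x < b -> is_derive x 1 F (k x)) ->
  k x @[x --> a^'+] --> l -> g x @[x --> a^'+] --> 0 ->
  F x * g x @[x --> a^'+] --> 0.
Proof.
move=> ab Fk kl g0.
have [e e0 He] : exists2 e : R, 0 < e &
    forall x, a < x < a + e -> `|k x| <= `|l| + 1.
  have : \forall x \near a^'+, `|k x| <= `|l| + 1.
    near=> x; have : `|l - k x| <= 1.
      by near: x; move/cvgrPdist_le : kl; apply.
    move=> H; rewrite -(subrK l (k x)) addrC (le_trans (ler_normD _ _))// lerD2l.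
    by rewrite distrC.
  move=> [e /= e0 He]; exists e => // x /andP[ax xe]; apply: He => //=.
  by rewrite distrC gtr0_norm ?subr_gt0// ltrBlDl.
(* Between [a] and [m], both the differentiability of [F] and the bound on [k] hold. *)
pose m := Num.min b (a + e).
have am : a < m by rewrite lt_min ab ltrDl.
pose x0 := (a + m) / 2.
have ax0 : a < x0 by rewrite /x0; lra.
have x0m : x0 < m by rewrite /x0; lra.
have [mb me] : m <= b /\ m <= a + e by split; rewrite ge_min lexx ?orbT.
(* Mean value bound: the size of [F] at [x0] plus the slope bound times the length. *)
pose M := `|F x0| + (`|l| + 1) * (x0 - a).
have FM x : a < x < x0 -> `|F x| <= M.
  move=> /andP[ax xx0].
  have [t /andP[xt tx0] E] := MVT_oo Fk ax xx0 (lt_le_trans x0m mb).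
  have -> : F x = F x0 - k t * (x0 - x) by rewrite -E; ring.
  rewrite (le_trans (ler_normB _ _))// lerD2l normrM.
  rewrite (gtr0_norm (_ : 0 < x0 - x)) ?subr_gt0// ler_pM//.
  - by rewrite subr_ge0 ltW.
  - apply: He; rewrite (lt_trans ax xt)/=.
    by rewrite (lt_le_trans (lt_trans tx0 x0m) me).
  - by rewrite lerD2l lerN2 ltW.
have Mg0 : M * `|g x| @[x --> a^'+] --> 0.
  rewrite -(mulr0 M) -(@normr0 R R); apply: cvgM; first exact: cvg_cst.
  exact: cvg_norm.
apply/norm_cvg0P.
have near_le : \forall x \near a^'+, (0 : R) <= `|F x * g x| <= M * `|g x|.
  apply: (near_at_rightP ax0) => x xx0.
  by rewrite normr_ge0/= normrM ler_wpM2r// FM.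
exact: (squeeze_cvgr near_le (cvg_cst 0) Mg0).
Unshelve. all: by end_near. Qed.

(** The interval is open because derivatives jump at the lens planes and only one-sided data are
    given at redshift 0; boundary values enter through limits. *)
Definition solves (phi rho : R -> R) a b f F := forall x, a < x < b ->
  is_derive x 1 f (phi x * F x) /\ is_derive x 1 F (rho x * f x).

Definition wronskian f F g G x := f x * G x - F x * g x.

(** Both pairs share [phi] and [rho], so the terms [phi F G] and [rho f g] cancel in the derivative
    of the Wronskian. *)
Lemma wronskian_constant phi rho a b f F g G :
  solves phi rho a b f F -> solves phi rho a b g G ->
  forall x y, a < x < b -> a < y < b ->
    wronskian f F g G x = wronskian f F g G y.
Proof.
move=> fF gG; apply: constant_oo => x xab.
have [df dF] := fF x xab; have [dg dG] := gG x xab.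
apply: is_derive_eq; rewrite -![_ *: _]/(_ * _); ring.
Qed.

(* The determinant identity [y W(g,d) + g W(d,y) + d W(y,g) = 0], read at [b-]. *)
Lemma wronskian_propagation phi rho a b y Y d D g G (m ya da yb db gb : R) :
  a < b ->
  solves phi rho a b y Y -> solves phi rho a b d D -> solves phi rho a b g G ->
  wronskian y Y g G x @[x --> a^'+] --> m * ya ->
  wronskian d D g G x @[x --> a^'+] --> m * da ->
  y x @[x --> b^'-] --> yb -> d x @[x --> b^'-] --> db ->
  g x @[x --> b^'-] --> gb ->
  forall x, a < x < b ->
    gb * wronskian d D y Y x = m * (yb * da - db * ya).
Proof.
move=> ab sy sd sg Wyg Wdg yyb ddb ggb x xab.
have Wy := eq_at_right_lim ab (wronskian_constant sy sg) Wyg.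
have Wd := eq_at_right_lim ab (wronskian_constant sd sg) Wdg.
(* Replacing [m * ya] and [m * da] by the constant Wronskians with [g] leaves a polynomial
   identity. *)
have H t : a < t < b ->
    g t * wronskian d D y Y x - m * (y t * da - d t * ya) = 0.
  move=> tab; rewrite (wronskian_constant sd sy xab tab).
  have {}Wy := Wy t tab; have {}Wd := Wd t tab.
  have -> : m * (y t * da - d t * ya) = y t * (m * da) - d t * (m * ya) by ring.
  by rewrite -Wy -Wd /wronskian; ring.
apply/eqP; rewrite -subr_eq0; apply/eqP; symmetry.
(* [h] vanishes on the whole interval, so its left limit at [b] vanishes too. *)
pose h t := g t * wronskian d D y Y x - m * (y t * da - d t * ya).
rewrite -[LHS](H x xab).
apply: (@eq_at_left_lim h a b) xab => //.
  by move=> u v uab vab; rewrite /h !H.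
apply: cvgB; first by apply: cvgM => //; exact: cvg_cst.
apply: cvgM; first exact: cvg_cst.
by apply: cvgB; apply: cvgM => //; exact: cvg_cst.
Qed.

End calculus.

(** * The Dyer-Roeder equation as a first-order system, and positivity of the distances *)

Section dyer_roeder_theory.
Context {R : realType}.
Variables c H0 Omega alpha : R.
Hypotheses (c_gt0 : 0 < c) (H0_gt0 : 0 < H0) (Omega_ge0 : 0 <= Omega).
Hypothesis alpha_le1 : alpha <= 1.
Implicit Types (a b x : R) (B : R -> R).

Definition hubble x := Num.sqrt (Omega * x + 1).
(** Derivative of the affine parameter in the redshift. [dlambda] and [tidal] are the coefficients
    [phi] and [rho] of the system. *)
Definition dlambda x : R := c / H0 * ((1 + x) ^+ 3 * hubble x)^-1.
Definition tidal x := dlambda x * convergence_bg c H0 Omega alpha x.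
(* The derivative of [B] with respect to the affine parameter. *)
Definition momentum B x := (1 + x) ^+ 3 * hubble x * (H0 / c) * derive1 B x.

Lemma radicand_gt0 x : 0 <= x -> 0 < Omega * x + 1.
Proof. by move=> x0; rewrite ltr_wpDl// mulr_ge0. Qed.

Lemma hubble_gt0 x : 0 <= x -> 0 < hubble x.
Proof. by move=> x0; rewrite sqrtr_gt0 radicand_gt0. Qed.

Lemma sqr_hubble x : 0 <= x -> hubble x ^+ 2 = Omega * x + 1.
Proof. by move=> x0; rewrite sqr_sqrtr// ltW// radicand_gt0. Qed.

Lemma one_plus_redshift_gt0 x : 0 <= x -> 0 < 1 + x.
Proof. by move=> x0; lra. Qed.

Lemma dlambda_gt0 x : 0 <= x -> 0 < dlambda x.
Proof.
move=> x0; rewrite mulr_gt0 ?divr_gt0// invr_gt0 mulr_gt0 ?hubble_gt0//.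
by rewrite exprn_gt0// one_plus_redshift_gt0.
Qed.

Lemma is_derive_hubble x : 0 <= x ->
  is_derive x 1 hubble (Omega / (2 * hubble x)).
Proof.
move=> x0.
have d1 : is_derive x 1 (fun x => Omega * x + 1) Omega.
  by apply: is_derive_eq; rewrite -![_ *: _]/(_ * _); ring.
have d2 := is_derive1_sqrt (radicand_gt0 x0).
apply: (is_derive_eq (@is_derive1_comp R Num.sqrt _ x _ _ d2 d1)).
by rewrite mulrC.
Qed.

Lemma continuous_hubble : continuous hubble.
Proof.
move=> x; apply: continuous_comp; last exact: sqrt_continuous.
by apply: cvgD; [apply: cvgM; [exact: cvg_cst|exact: cvg_id]|exact: cvg_cst].
Qed.

Lemma continuous_dlambda x : 0 <= x -> {for x, continuous dlambda}.
Proof.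
move=> x0; apply: cvgM; first exact: cvg_cst.
apply: cvgV.
  by rewrite gt_eqF// mulr_gt0 ?hubble_gt0// exprn_gt0// one_plus_redshift_gt0.
apply: cvgM; last exact: continuous_hubble.
apply: (@continuous_comp _ _ _ (fun x : R => 1 + x) (fun x : R => x ^+ 3)).
  by apply: cvgD; [exact: cvg_cst|exact: cvg_id].
exact: exprn_continuous.
Qed.

Lemma continuous_tidal x : 0 <= x -> {for x, continuous tidal}.
Proof.
move=> x0; apply: cvgM; first exact: continuous_dlambda.
rewrite /convergence_bg; apply: cvgM; first exact: cvg_cst.
apply: (@continuous_comp _ _ _ (fun x : R => 1 + x) (fun x : R => x ^+ 5)).
  by apply: cvgD; [exact: cvg_cst|exact: cvg_id].
exact: exprn_continuous.
Qed.

Lemma dyer_roeder_continuous B x : dyer_roeder Omega alpha B -> 0 < x ->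
  {for x, continuous B}.
Proof.
by move=> [/continuous_within_itvcyP[cB _] _] x0; apply: cB; rewrite in_itv/= x0.
Qed.

Lemma dyer_roeder_cvg_right B x : dyer_roeder Omega alpha B -> 0 <= x ->
  B t @[t --> x^'+] --> B x.
Proof.
move=> drB; rewrite le_eqVlt => /predU1P[<-|x0].
  by case: drB => /continuous_within_itvcyP[].
by apply: cvg_at_right_filter; exact: dyer_roeder_continuous.
Qed.

(** The derivative of [momentum B] minus [tidal x * B x] is [H0 / c * (1 + x) ^+ 2 / hubble x] times
    the left side of the Dyer-Roeder equation. *)
Lemma dyer_roeder_solves B b : dyer_roeder Omega alpha B ->
  solves dlambda tidal 0 b B (momentum B).
Proof.
move=> [_ drB] x /andP[x0 _]; have [dB ddB eqB] := drB x x0.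
have s0 := hubble_gt0 (ltW x0); have x1 := one_plus_redshift_gt0 (ltW x0).
have s2 := sqr_hubble (ltW x0).
have dsx := is_derive_hubble (ltW x0).
have dB1 : is_derive x 1 B (derive1 B x) by rewrite derive1E; exact: derivableP.
have dB2 : is_derive x 1 (derive1 B) (derive1 (derive1 B) x).
  by rewrite [X in is_derive _ _ _ X]derive1E; exact: derivableP.
split.
- apply: (is_derive_eq dB1); rewrite /momentum /dlambda.
  field; rewrite ?gt_eqF//; by rewrite exprn_gt0.
- rewrite /momentum; apply: is_derive_eq.
  rewrite -![_ *: _]/(_ * _) /tidal /dlambda /convergence_bg.
  set s := hubble x in s0 s2 *; set B1 := derive1 B x in eqB *.
  set B2 := derive1 (derive1 B) x in eqB *.
  apply/eqP; rewrite -subr_eq0; apply/eqP.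
  transitivity (H0 / c * (1 + x) ^+ 2 / s * (s ^+ 2 * (1 + x) * B2
    + (3 * s ^+ 2 + (1 + x) * Omega / 2) * B1 + 3 / 2 * alpha * Omega * B x)).
    by field; rewrite !gt_eqF.
  rewrite s2 -[RHS](mulr0 (H0 / c * (1 + x) ^+ 2 / s)) -eqB; congr (_ * _).
  by field.
Qed.

(* Logarithmic derivative of [hubble x / (1 + x) ^+ 2], a positive solution of the
   Dyer-Roeder equation for [alpha = 1]. *)
Definition full_beam_log x :=
  H0 / c * (Omega / 2 - 2 - 3 / 2 * Omega * x) * (1 + x) ^+ 2 / hubble x.

(** Riccati equation: if [p'' = R p] in the affine parameter, then [w = p' / p] satisfies
    [w' = R - w ^ 2]; [dlambda] converts this to the redshift. *)
Lemma is_derive_full_beam_log x : 0 <= x -> is_derive x 1 full_beam_log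
  (dlambda x * (convergence_bg c H0 Omega 1 x - full_beam_log x ^+ 2)).
Proof.
move=> x0; have s0 := hubble_gt0 x0; have x1 := one_plus_redshift_gt0 x0.
have s2 := sqr_hubble x0.
have dsx := is_derive_hubble x0.
have sN0 : hubble x != 0 by rewrite gt_eqF.
have dV := is_deriveV sN0 dsx.
rewrite /full_beam_log; apply: is_derive_eq.
rewrite -![_ *: _]/(_ * _) /dlambda /convergence_bg.
(* Expressing the linear factor through [hubble x ^+ 2] leaves a rational identity in [hubble x]. *)
have P2 : Omega / 2 - 2 - 3 / 2 * Omega * x = (1 + x) * Omega / 2 - 2 * hubble x ^+ 2.
  by rewrite s2; field.
rewrite P2; field.
by rewrite !gt_eqF.
Qed.

(* The inverse square of the same positive solution. *)
Definition full_beam_weight x : R := (1 + x) ^+ 4 / (Omega * x + 1).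

Lemma is_derive_full_beam_weight x : 0 <= x -> is_derive x 1 full_beam_weight
  (- 2 * dlambda x * full_beam_log x * full_beam_weight x).
Proof.
move=> x0; have s0 := hubble_gt0 x0; have x1 := one_plus_redshift_gt0 x0.
have s2 := sqr_hubble x0.
have r0 : Omega * x + 1 != 0 by rewrite gt_eqF// radicand_gt0.
have d1 : is_derive x 1 (fun x => Omega * x + 1) Omega.
  by apply: is_derive_eq; rewrite -![_ *: _]/(_ * _); ring.
have dV := @is_deriveV R (fun x => Omega * x + 1) _ _ _ r0 d1.
rewrite /full_beam_weight; apply: is_derive_eq.
rewrite -![_ *: _]/(_ * _) /dlambda /full_beam_log.
have P2 : Omega / 2 - 2 - 3 / 2 * Omega * x = (1 + x) * Omega / 2 - 2 * hubble x ^+ 2.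
  by rewrite s2; field.
rewrite P2 -s2; field.
by rewrite !gt_eqF.
Qed.

(** The solution is positive just after [a] and cannot vanish later, because the square of its
    quotient by the positive solution for [alpha = 1] is nondecreasing; the intermediate value
    theorem then fixes its sign. *)
Lemma dyer_roeder_pos (r : R -> R -> R) a : 0 <= a ->
  dyer_roeder_from Omega alpha r a -> forall x, a < x -> 0 < r a x.
Proof.
move=> a0 [drB ra0 dra] x ax.
pose F := momentum (r a); pose b := x + 1.
have ab : a < b by rewrite /b; lra.
have sol t : a < t < b -> is_derive t 1 (r a) (dlambda t * F t) /\
    is_derive t 1 F (tidal t * r a t).
  move=> /andP[a_t tb]; apply: (dyer_roeder_solves drB (b := b)).
  by rewrite (le_lt_trans a0 a_t).
have rcvg : r a t @[t --> a^'+] --> 0.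
  by rewrite -ra0; exact: dyer_roeder_cvg_right.
(* Picone: [G] is nondecreasing from 0, and its sign is that of the derivative of
   the squared quotient [E] of [r a] by the positive solution for [alpha = 1]. *)
pose G t := r a t * (F t - r a t * full_beam_log t).
have dG t : a < t < b -> is_derive t 1 G (dlambda t *
    ((F t - r a t * full_beam_log t) ^+ 2 +
     r a t ^+ 2 * (convergence_bg c H0 Omega alpha t
                   - convergence_bg c H0 Omega 1 t))).
  move=> atb; have [d1 d2] := sol t atb.
  have t0 : 0 <= t by case/andP: atb => /ltW /(le_trans a0).
  have d3 := is_derive_full_beam_log t0.
  apply: is_derive_eq; rewrite -![_ *: _]/(_ * _) /tidal; ring.
have G0 : G t @[t --> a^'+] --> 0.
  have H1 : F t * r a t @[t --> a^'+] --> 0.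
    apply: (cvg_mul_derive_bounded ab (fun t tab => (sol t tab).2)) => //.
    apply: cvgM; last exact: rcvg.
    by apply: cvg_at_right_filter; exact: continuous_tidal.
  have H2 : r a t * r a t * full_beam_log t @[t --> a^'+] -->
      0 * 0 * full_beam_log a.
    apply: cvgM; first exact: cvgM.
    apply: cvg_at_right_filter.
    exact: (is_derive_continuous (is_derive_full_beam_log a0)).
  have -> : G = fun t => F t * r a t - r a t * r a t * full_beam_log t.
    by apply/funext => t; rewrite /G; ring.
  have := cvgB H1 H2; rewrite !mul0r subr0 => H3.
  exact: H3.
have Gge0 t : a < t < b -> 0 <= G t.
  move=> /andP[a_t tb]; rewrite leNgt; apply/negP => Gt0.
  (* If [G t] were negative, points close to [a] would have a larger value of [G], which tends to 0
     there; this contradicts monotonicity. *)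
  have [y [Gy ay yt]] : exists y, [/\ G t < G y, a < y & y < t].
    apply: (@filter_ex _ a^'+); near=> y; split.
    - by near: y; apply: cvgr_gt G0 _ Gt0.
    - by [].
    - by near: y; exact: nbhs_right_lt.
  have : G y <= G t.
    apply: (nondecreasing_oo dG _ ay (ltW yt) tb) => u /andP[au ub].
    have u0 : 0 <= u by rewrite (le_trans a0)// ltW.
    rewrite mulr_ge0 ?(ltW (dlambda_gt0 _))// addr_ge0 ?sqr_ge0// mulr_ge0 ?sqr_ge0//.
    rewrite /convergence_bg.
    (* Here [alpha <= 1] decides the sign: the source of convergence for [alpha] is at least the one
       for 1. *)
    have -> : - (3 / 2) * (H0 / c) ^+ 2 * alpha * Omega * (1 + u) ^+ 5 -
      - (3 / 2) * (H0 / c) ^+ 2 * 1 * Omega * (1 + u) ^+ 5 =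
      (3 / 2) * (H0 / c) ^+ 2 * (1 - alpha) * Omega * (1 + u) ^+ 5 by ring.
    rewrite !mulr_ge0 ?sqr_ge0 ?subr_ge0 ?exprn_ge0 ?(ltW (one_plus_redshift_gt0 _))//;
      by rewrite ?invr_ge0 ltW.
  by rewrite leNgt Gy.
pose E t := r a t ^+ 2 * full_beam_weight t.
have Wgt0 t : 0 <= t -> 0 < full_beam_weight t.
  by move=> t0; rewrite divr_gt0 ?radicand_gt0// exprn_gt0// one_plus_redshift_gt0.
have dE t : a < t < b ->
    is_derive t 1 E (2 * dlambda t * full_beam_weight t * G t).
  move=> atb; have [d1 d2] := sol t atb.
  have t0 : 0 <= t by case/andP: atb => /ltW /(le_trans a0).
  have d3 := is_derive_full_beam_weight t0.
  apply: is_derive_eq; rewrite -![_ *: _]/(_ * _) /G; ring.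
have [t [rt a_t tx]] : exists t, [/\ 0 < r a t, a < t & t < x].
  have dl : 0 < ((1 + a) ^+ 2 * Num.sqrt (Omega * a + 1))^-1.
    by rewrite invr_gt0 mulr_gt0 ?hubble_gt0// exprn_gt0// one_plus_redshift_gt0.
  have [h [h0 hx]] : exists h : R, [/\ 0 < h, h < x - a &
      0 < h^-1 *: (r a (a + h) - r a a)].
    apply: (@filter_ex _ (0 : R)^'+); near=> h; split.
    - by [].
    - by near: h; apply: nbhs_right_lt; rewrite subr_gt0.
    - by near: h; apply: cvgr_gt dra _ dl.
  rewrite ra0 subr0 -[_ *: _]/(_ * _) pmulr_rgt0 ?invr_gt0// => rh.
  by exists (a + h); split; rewrite ?ltrDl// -ltrBrDl.
have xb : x < b by rewrite /b; lra.
(* A zero [y] beyond [t] would give [E t <= E y = 0], although [E t] is positive. *)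
have rN0 y : t <= y -> y <= x -> r a y != 0.
  move=> ty yx; apply: contraTneq isT => ry0.
  have := nondecreasing_oo dE _ a_t ty (le_lt_trans yx xb).
  rewrite /E ry0 expr0n mul0r => H.
  have : r a t ^+ 2 * full_beam_weight t <= 0.
    apply: H => u /[dup] uab /andP[au _].
    have u0 : 0 <= u by rewrite (le_trans a0)// ltW.
    apply: mulr_ge0; last exact: Gge0.
    apply: mulr_ge0; last exact: ltW (Wgt0 _ u0).
    by apply: mulr_ge0 => //; exact: ltW (dlambda_gt0 u0).
  rewrite leNgt mulr_gt0 ?exprn_gt0 ?Wgt0//.
  by rewrite (le_trans a0)// ltW.
rewrite ltNge; apply/negP => rx0.
have [||y] := @IVT R (r a) t x 0 (ltW tx).
- apply: continuous_subspaceW (proj1 drB) => y; rewrite /= !in_itv/= andbT.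
  by move=> /andP[ty _]; rewrite (le_trans _ ty)// (le_trans a0)// ltW.
- by rewrite ge_min rx0 orbT/= le_max (ltW rt).
- by rewrite in_itv/= => /andP[ty yx] /eqP; apply/negP; exact: rN0.
Unshelve. all: by end_near. Qed.

End dyer_roeder_theory.

(** * The affine parameter as a strictly increasing change of variable *)

Section affine_parameter_theory.
Context {R : realType}.
Variables c H0 Omega : R.
Hypotheses (c_gt0 : 0 < c) (H0_gt0 : 0 < H0) (Omega_ge0 : 0 <= Omega).
Implicit Types x y : R.

Let lambda := affine_parameter c H0 Omega.
Let integrand x : R := ((1 + x) ^+ 3 * Num.sqrt (Omega * x + 1))^-1.

Lemma integrandE x : integrand x = (c / H0)^-1 * dlambda c H0 Omega x.
Proof.
by rewrite /dlambda mulrA mulVf ?mul1r// mulf_neq0 ?invr_eq0 ?gt_eqF.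
Qed.

Lemma continuous_integrand x : 0 <= x -> {for x, continuous integrand}.
Proof.
move=> x0; rewrite (funext integrandE).
by apply: cvgM; [exact: cvg_cst|exact: continuous_dlambda].
Qed.

Lemma integrable_integrand b :
  (@lebesgue_measure R).-integrable `[0, b] (EFin \o integrand).
Proof.
apply: continuous_compact_integrable; first exact: segment_compact.
apply: continuous_in_subspaceT => x; rewrite inE/= in_itv/= => /andP[x0 _].
exact: continuous_integrand.
Qed.

Lemma affine_parameter0 : lambda 0 = 0.
Proof. by rewrite /lambda /affine_parameter set_itv1 Rintegral_set1 mulr0. Qed.

Lemma is_derive_affine_parameter x : 0 < x ->
  is_derive x 1 lambda (dlambda c H0 Omega x).
Proof.
move=> x0; have xx1 : x < x + 1 by rewrite ltrDl.
have [d1 d2] := continuous_FTC1_closed xx1 (integrable_integrand (x + 1)) x0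
  (continuous_integrand (ltW x0)).
have d3 : is_derive x 1
    (fun x => \int[lebesgue_measure]_(t in `[0, x]) integrand t) (integrand x).
  by rewrite -d2 derive1E; exact: derivableP.
apply: is_derive_eq.
by [].
Qed.

Lemma continuous_affine_parameter b : 0 <= b ->
  {within `[0, b], continuous lambda}.
Proof.
move=> b0.
have H := parameterized_integral_continuous b0 (integrable_integrand b).
move=> x; apply: cvgM; first exact: cvg_cst.
exact: H.
Qed.

Lemma affine_parameter_lt x y : 0 <= x -> x < y -> lambda x < lambda y.
Proof.
move=> x0 xy.
have [t||t] := @MVT R lambda (dlambda c H0 Omega) x y xy.
- rewrite in_itv/= => /andP[xt _]; apply: is_derive_affine_parameter.
  exact: le_lt_trans xt.
- apply: continuous_subspaceW (continuous_affine_parameter (le_trans x0 (ltW xy))).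
  by move=> u; rewrite /= !in_itv/= => /andP[xu ->]; rewrite (le_trans x0 xu).
- rewrite in_itv/= => /andP[xt _] E.
  rewrite -subr_gt0 E mulr_gt0 ?subr_gt0// dlambda_gt0//.
  by rewrite (le_trans x0)// ltW.
Qed.

(** Strict monotonicity keeps the image on the right-hand side, so one-sided limits in the affine
    parameter can be read in the redshift. *)
Lemma affine_parameter_cvg_right x : 0 <= x ->
  lambda t @[t --> x^'+] --> (lambda x)^'+.
Proof.
move=> x0.
have H : lambda t @[t --> x^'+] --> lambda x.
  (* At 0 the limit comes from continuity within [[0, 1]], elsewhere from differentiability. *)
  move: x0; rewrite le_eqVlt => /predU1P[<-|x0].
    by have [] := proj1 (continuous_within_itvP _ ltr01)
        (continuous_affine_parameter ler01).
  apply: cvg_at_right_filter.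
  exact: (is_derive_continuous (is_derive_affine_parameter x0)).
move=> P HP; rewrite /nbhs/=; near=> t.
have xt : x < t by [].
move: (affine_parameter_lt x0 xt); near: t; exact: H HP.
Unshelve. all: by end_near. Qed.

Lemma affine_parameter_cvg_left x : 0 < x ->
  lambda t @[t --> x^'-] --> (lambda x)^'-.
Proof.
move=> x0.
have H : lambda t @[t --> x^'-] --> lambda x.
  apply: cvg_at_left_filter.
  exact: (is_derive_continuous (is_derive_affine_parameter x0)).
move=> P HP; rewrite /nbhs/=; near=> t.
have t0 : 0 < t by near: t; exact: nbhs_left_gt.
have tx : t < x by [].
move: (affine_parameter_lt (ltW t0) tx); near: t; exact: H HP.
Unshelve. all: by end_near. Qed.

(** L'Hopital's rule, as differentiability of [lambda] is established only at positive redshift. The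
    limit converts the initial slope of the Jacobi matrix into a slope in the redshift. *)
Lemma affine_parameter_slope0 :
  lambda t / t @[t --> 0^'+] --> dlambda c H0 Omega 0.
Proof.
have dl x : x \in `]0, 1[ -> is_derive x 1 lambda (dlambda c H0 Omega x).
  by rewrite in_itv/= => /andP[x0 _]; exact: is_derive_affine_parameter.
have did (x : R) : x \in `]0, 1[ -> is_derive x 1 (id : R -> R) 1.
  by move=> _; exact: is_derive_id.
have l0 : lambda t @[t --> 0^'+] --> 0.
  have := affine_parameter_cvg_right (lexx 0); rewrite affine_parameter0 => H.
  exact: (cvg_trans H (cvg_within _)).
have id0 : (id : R -> R) t @[t --> 0^'+] --> 0.
  by apply: cvg_at_right_filter; exact: cvg_id.
apply: (lhopital_at_right ltr01 dl did l0 id0).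
  by move=> x _; exact: oner_neq0.
rewrite -[X in _ --> X]divr1; apply: cvgM; last exact: cvg_cst.
by apply: cvg_at_right_filter; exact: continuous_dlambda.
Qed.

End affine_parameter_theory.

(** * From matrices to entries, and from one-sided to ordinary derivatives *)

Lemma matrix_entry_cvg (R : realType) (T : Type) (F : set_system T)
    {FF : Filter F} m n (M : T -> 'M[R]_(m, n)) (L : 'M[R]_(m, n)) i j :
  M t @[t --> F] --> L -> M t i j @[t --> F] --> L i j.
Proof. by move=> ML; exact: cvg_comp ML (@coord_continuous R m n i j L). Qed.

Lemma matrix_entry_is_derive (R : realType) m n (M : R -> 'M[R]_(m, n)) t i j :
  derivable M t 1 -> is_derive t 1 (fun u => M u i j) (derive1 M t i j).
Proof.
move=> dM; have dMij := (derivable_mxP M t 1).1 dM i j.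
by apply: DeriveDef => //; rewrite derive1E derive_mx// mxE.
Qed.

(** Uniqueness of limits; it reads the one-sided normalisation of [r a] as an ordinary derivative
    when [a] is positive. *)
Lemma right_derivative_derive1 (R : realType) (V : normedModType R)
    (f : R -> V) a l :
  derivable f a 1 -> has_right_derivative f a l -> derive1 f a = l.
Proof.
move=> df fl; have H : h^-1 *: (f (a + h) - f a) @[h --> 0^'+] --> derive1 f a.
  apply: cvg_dnbhs_at_right.
  have -> : (fun h => h^-1 *: (f (a + h) - f a)) =
            (fun h => h^-1 *: (f (h + a) - f a)).
    by apply/funext => h; rewrite (addrC a).
  move: df; rewrite /derive1 /derivable.
  have -> : (fun h : R => h^-1 *: (f (h *: 1 + a) - f a)) =
            (fun h : R => h^-1 *: (f (h + a) - f a)) => //.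
  by apply/funext => h; rewrite -[h *: _]/(h * _) mulr1.
exact: (cvg_unique _ H fl).
Qed.

(** * Limits of Wronskians at the base point of a distance function *)

Section wronskian_at_source.
Context {R : realType}.
Variables c H0 Omega alpha : R.
Hypotheses (c_gt0 : 0 < c) (H0_gt0 : 0 < H0) (Omega_ge0 : 0 <= Omega).

Lemma tidal_cvg_right (f : R -> R) a l : 0 <= a -> f t @[t --> a^'+] --> l ->
  tidal c H0 Omega alpha t * f t @[t --> a^'+] --> tidal c H0 Omega alpha a * l.
Proof.
move=> a0 fl; apply: cvgM; last exact: fl.
by apply: cvg_at_right_filter; exact: continuous_tidal.
Qed.

(* At [a = 0] the limits of the derivatives are not available; they are bounded,
   which suffices since [f] vanishes there. *)
Lemma wronskian_dyer_roeder_from (r : R -> R -> R) (f F : R -> R) a b fa :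
  0 <= a -> a < b -> dyer_roeder_from Omega alpha r a ->
  solves (dlambda c H0 Omega) (tidal c H0 Omega alpha) a b f F ->
  f x @[x --> a^'+] --> fa -> (a = 0 -> fa = 0) ->
  wronskian f F (r a) (momentum c H0 Omega (r a)) x @[x --> a^'+] -->
    (H0 / c * (1 + a)) * fa.
Proof.
move=> a0 ab [drB ra0 dra] sol ffa fa0.
have rcvg : r a t @[t --> a^'+] --> 0.
  by rewrite -ra0; exact: (dyer_roeder_cvg_right drB).
have H1 : F x * r a x @[x --> a^'+] --> 0.
  apply: (cvg_mul_derive_bounded ab (fun t tab => (sol t tab).2) _ rcvg).
  exact: tidal_cvg_right ffa.
suff H2 : f x * momentum c H0 Omega (r a) x @[x --> a^'+] --> H0 / c * (1 + a) * fa.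
  by rewrite -[X in _ --> X]subr0; apply: cvgB.
move: (a0); rewrite le_eqVlt => /predU1P[a_eq0|a_gt0].
  have fa00 : fa = 0 by apply: fa0.
  rewrite fa00 mulr0; rewrite fa00 in ffa.
  have sr := dyer_roeder_solves c_gt0 H0_gt0 Omega_ge0 (b := b) drB.
  have sr' x : a < x < b -> is_derive x 1 (momentum c H0 Omega (r a))
      (tidal c H0 Omega alpha x * r a x).
    by move=> /andP[ax xb]; apply: (sr x _).2; rewrite (le_lt_trans a0 ax).
  have -> : (fun x => f x * momentum c H0 Omega (r a) x) =
            (fun x => momentum c H0 Omega (r a) x * f x).
    by apply/funext => t; rewrite mulrC.
  exact: cvg_mul_derive_bounded ab sr' (tidal_cvg_right a0 rcvg) ffa.
rewrite mulrC; apply: cvgM; first exact: ffa.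
have ab0 : 0 < a < a + 1 by rewrite a_gt0 ltrDl ltr01.
have [_ dm] := dyer_roeder_solves c_gt0 H0_gt0 Omega_ge0 drB ab0.
(* The initial slope of [r a] is the inverse of [(1 + a) ^+ 2 * hubble Omega a], and the momentum
   multiplies it by [(1 + a) ^+ 3 * hubble Omega a * (H0 / c)]. *)
have -> : H0 / c * (1 + a) = momentum c H0 Omega (r a) a.
  case: drB => _ /(_ a a_gt0) [dr _ _].
  rewrite /momentum (right_derivative_derive1 dr dra) -/(hubble Omega a).
  have s0 := hubble_gt0 Omega_ge0 a0; have a1 := one_plus_redshift_gt0 a0.
  by field; rewrite !gt_eqF.
apply: cvg_at_right_filter; exact: is_derive_continuous dm.
Qed.

End wronskian_at_source.

(** * The Jacobi matrix between and across the lens planes *)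

Section multiple_lens_planes.
Context {R : realType}.
Variables (c H0 Omega alpha : R) (N : nat) (z : nat -> R).
Variables (r : R -> R -> R) (Ut : nat -> 'M[R]_2) (J : R -> 'M[R]_2).
Hypotheses (c_gt0 : 0 < c) (H0_gt0 : 0 < H0) (Omega_ge0 : 0 <= Omega).
Hypotheses (alpha_le1 : alpha <= 1) (z0 : z 0%N = 0).
Hypothesis z_incr : forall i : nat, (i <= N)%N -> z i < z i.+1.
Hypothesis r_sol :
  forall i : nat, (i <= N.+1)%N -> dyer_roeder_from Omega alpha r (z i).
Hypothesis J_sol : jacobi_solution c H0 Omega alpha N z Ut J.

Let lambda := affine_parameter c H0 Omega.
Let phi := dlambda c H0 Omega.
Let rho := tidal c H0 Omega alpha.
(** [Y] is the derivative of the entry in the affine parameter, evaluated at redshift [x]. [d] omits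
    the factor [c / H0] of the distance, and [D] is here its momentum. *)
Let y k l x := J (lambda x) k l.
Let Y k l x := derive1 J (lambda x) k l.
Let d := r (z 0%N).
Let D := momentum c H0 Omega d.

Lemma redshift_le i j : (i <= j)%N -> (j <= N.+1)%N -> z i <= z j.
Proof.
elim: j => [|j IH]; first by rewrite leqn0 => /eqP ->.
rewrite leq_eqVlt ltnS => /predU1P[->//|ij] jN.
by rewrite (le_trans (IH ij (ltnW jN)))// ltW// z_incr.
Qed.

Lemma redshift_ge0 i : (i <= N.+1)%N -> 0 <= z i.
Proof. by move=> iN; rewrite -z0 redshift_le. Qed.

Lemma redshift_lt i j : (i < j)%N -> (j <= N.+1)%N -> z i < z j.
Proof.
move=> ij jN; apply: lt_le_trans (redshift_le ij jN).
by apply: z_incr; rewrite -ltnS (leq_trans ij).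
Qed.

Lemma redshift_gt0 i : (1 <= i <= N.+1)%N -> 0 < z i.
Proof. by move=> /andP[i1 iN]; rewrite -z0 redshift_lt. Qed.

Lemma distance_pos i j : (i < j)%N -> (j <= N.+1)%N -> 0 < r (z i) (z j).
Proof.
move=> ij jN; have iN : (i <= N.+1)%N := leq_trans (ltnW ij) jN.
have zi0 := redshift_ge0 iN.
exact: (dyer_roeder_pos c_gt0 H0_gt0 Omega_ge0 alpha_le1 zi0 (r_sol iN)
  (redshift_lt ij jN)).
Qed.

Lemma jacobi_solves i k l : (i <= N)%N ->
  solves phi rho (z i) (z i.+1) (y k l) (Y k l).
Proof.
move=> iN x xi; case: J_sol => _ _ _ /(_ i x iN xi)[dJ ddJ eqJ] _.
have x0 : 0 < x.
  by case/andP: xi => zx _; rewrite (le_lt_trans _ zx)// redshift_ge0// ltnW.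
have dl := is_derive_affine_parameter c_gt0 H0_gt0 Omega_ge0 x0.
have d1 := matrix_entry_is_derive k l dJ.
have d2 := matrix_entry_is_derive k l ddJ.
split.
- by apply: (is_derive_eq (is_derive1_comp d1 dl)); rewrite mulrC.
- apply: (is_derive_eq (is_derive1_comp d2 dl)).
  by rewrite eqJ mxE /rho /tidal /y; ring.
Qed.

Lemma jacobi_entry_cvg_right i k l : (i <= N)%N ->
  y k l t @[t --> (z i)^'+] --> y k l (z i).
Proof.
move=> iN; have zi0 := redshift_ge0 (leqW iN).
have l0 : lambda (z 0%N) = 0 by rewrite z0 /lambda affine_parameter0.
have lN : lambda (z 0%N) < lambda (z N.+1).
  by apply: affine_parameter_lt => //; [rewrite z0|exact: redshift_lt].
suff H : J u @[u --> (lambda (z i))^'+] --> J (lambda (z i)).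
  exact: (matrix_entry_cvg (i := k) (j := l)
    (cvg_comp _ _ (affine_parameter_cvg_right c_gt0 H0_gt0 Omega_ge0 zi0) H)).
case: J_sol => cJ _ _ _ _; rewrite -l0 in cJ lN.
have [cJo cJ0 _] := proj1 (continuous_within_itvP _ lN) cJ.
(* For [i = 0] the point is the left endpoint, where continuity is one-sided; the other planes are
   interior. *)
case: i iN zi0 => [//|i] iN zi0.
apply: cvg_at_right_filter; apply: cJo; rewrite in_itv/=.
rewrite !affine_parameter_lt//; first exact: redshift_lt.
  by rewrite z0.
by apply: redshift_lt => //; exact: ltnW.
Qed.

Lemma jacobi_entry_cvg_left i k l : (1 <= i <= N.+1)%N ->
  y k l t @[t --> (z i)^'-] --> y k l (z i).
Proof.
move=> /andP[i1 iN]; have zi0 : 0 < z i by rewrite redshift_gt0 ?i1.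
have l0 : lambda (z 0%N) = 0 by rewrite z0 /lambda affine_parameter0.
have lN : lambda (z 0%N) < lambda (z N.+1).
  by apply: affine_parameter_lt => //; [rewrite z0|exact: redshift_lt].
suff H : J u @[u --> (lambda (z i))^'-] --> J (lambda (z i)).
  exact: (matrix_entry_cvg (i := k) (j := l)
    (cvg_comp _ _ (affine_parameter_cvg_left c_gt0 H0_gt0 Omega_ge0 zi0) H)).
case: J_sol => cJ _ _ _ _; rewrite -l0 in cJ lN.
have [cJo _ cJN] := proj1 (continuous_within_itvP _ lN) cJ.
(* For [i = N.+1] the point is the right endpoint, where continuity is one-sided. *)
move: iN; rewrite leq_eqVlt => /predU1P[->//|iN].
apply: cvg_at_left_filter; apply: cJo; rewrite in_itv/=.
apply/andP; split; apply: affine_parameter_lt => //; rewrite ?z0 ?(ltW zi0)//.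
exact: redshift_lt.
Qed.

Lemma distance_continuous i x : (i <= N.+1)%N -> 0 < x ->
  {for x, continuous (r (z i))}.
Proof.
by move=> iN x0; case: (r_sol iN) => dr _ _; exact: (dyer_roeder_continuous dr).
Qed.

Lemma distance_solves i j : (i <= N.+1)%N -> (j <= N)%N ->
  solves phi rho (z j) (z j.+1) (r (z i)) (momentum c H0 Omega (r (z i))).
Proof.
move=> iN jN x /andP[zx _]; case: (r_sol iN) => dr _ _.
apply: (dyer_roeder_solves c_gt0 H0_gt0 Omega_ge0 dr (b := x + 1)).
by rewrite ltrDl ltr01 andbT (le_lt_trans _ zx)// redshift_ge0// ltnW.
Qed.

Lemma jacobi0 k l : y k l (z 0%N) = 0.
Proof.
by case: J_sol => _ J0 _ _ _; rewrite /y z0 /lambda affine_parameter0 J0 mxE.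
Qed.

Lemma distance0 : d (z 0%N) = 0.
Proof. by case: (r_sol (leq0n _)). Qed.

(** Instance of [wronskian_propagation] with [g = r (z i)], whose Wronskian limits at [z i] supply
    the factor [H0 / c * (1 + z i)]. *)
Lemma wronskian_segment i k l x : (i <= N)%N -> z i < x < z i.+1 ->
  r (z i) (z i.+1) * wronskian d D (y k l) (Y k l) x =
  H0 / c * (1 + z i) * (y k l (z i.+1) * d (z i) - d (z i.+1) * y k l (z i)).
Proof.
move=> iN xi; have iN' := leqW iN; have zi0 := redshift_ge0 iN'.
have zi1 : 0 < z i.+1 by exact: redshift_gt0.
have zlt := z_incr iN.
(* The base point is at redshift 0 only for [i = 0], where [y] and [d] both vanish, as the limit
   lemma requires. *)
have i0 : z i = 0 -> i = 0%N.
  case: i {xi zi0 zi1 zlt} iN iN' => // i iN iN'.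
  by have := @redshift_gt0 i.+1; rewrite iN' => /(_ isT) /gt_eqF/eqP.
have y0 : z i = 0 -> y k l (z i) = 0 by move=> /i0 ->; exact: jacobi0.
have d0 : z i = 0 -> d (z i) = 0 by move=> /i0 ->; exact: distance0.
have d_right : d t @[t --> (z i)^'+] --> d (z i).
  by case: (r_sol (leq0n _)) => dr _ _; exact: (dyer_roeder_cvg_right dr zi0).
have sy := jacobi_solves k l iN.
have sd := distance_solves (leq0n N.+1) iN.
have Wy := wronskian_dyer_roeder_from c_gt0 H0_gt0 Omega_ge0 zi0 zlt (r_sol iN')
  sy (@jacobi_entry_cvg_right i k l iN) y0.
have Wd := wronskian_dyer_roeder_from c_gt0 H0_gt0 Omega_ge0 zi0 zlt (r_sol iN')
  sd d_right d0.
have left_cvg j : (j <= N.+1)%N -> r (z j) t @[t --> (z i.+1)^'-] --> r (z j) (z i.+1).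
  by move=> jN; apply: cvg_at_left_filter; exact: distance_continuous.
exact: (wronskian_propagation zlt sy sd (distance_solves iN' iN) Wy Wd
  (@jacobi_entry_cvg_left i.+1 k l iN) (left_cvg _ (leq0n _)) (left_cvg _ iN') xi).
Qed.

(** [d], [D] and [y] are continuous across the plane, so only the term [d * Y] of the Wronskian
    jumps. *)
Lemma wronskian_jump n k l : (1 <= n <= N)%N -> forall x x',
  z n.-1 < x < z n -> z n < x' < z n.+1 ->
  wronskian d D (y k l) (Y k l) x' - wronskian d D (y k l) (Y k l) x =
  - (d (z n) * (1 + z n) * (Ut n *m J (lambda (z n))) k l).
Proof.
move=> /[dup] nN /andP[n1 nN'] x x' xn xn'.
have zn0 : 0 < z n by apply: redshift_gt0; rewrite n1 ltnW.
case: J_sol => _ _ _ _ /(_ n nN) [Jm [Jp [Jml Jpl eqJ]]].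
have n1N : (n.-1 <= N)%N := leq_trans (leq_pred n) nN'.
have zlt : z n.-1 < z n by rewrite -{2}(prednK n1) z_incr.
have sm : solves phi rho (z n.-1) (z n) (y k l) (Y k l).
  by rewrite -{2}(prednK n1); exact: jacobi_solves.
have dm : solves phi rho (z n.-1) (z n) d D.
  by rewrite -{2}(prednK n1); apply: distance_solves.
have cd : {for z n, continuous d} by exact: distance_continuous.
have zn01 : 0 < z n < z n + 1 by rewrite zn0 ltrDl ltr01.
have cD : {for z n, continuous D}.
  case: (r_sol (leq0n _)) => dr _ _.
  exact: (is_derive_continuous
    (dyer_roeder_solves c_gt0 H0_gt0 Omega_ge0 dr zn01).2).
have Wm : wronskian d D (y k l) (Y k l) x = d (z n) * Jm k l - D (z n) * y k l (z n).
  apply: (eq_at_left_lim zlt (wronskian_constant dm sm) _ xn).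
  apply: cvgB; apply: cvgM.
  - exact: cvg_at_left_filter.
  - exact: (matrix_entry_cvg (i := k) (j := l)
      (cvg_comp _ _ (affine_parameter_cvg_left c_gt0 H0_gt0 Omega_ge0 zn0) Jml)).
  - exact: cvg_at_left_filter.
  - by apply: jacobi_entry_cvg_left; rewrite n1 ltnW.
have Wp : wronskian d D (y k l) (Y k l) x' = d (z n) * Jp k l - D (z n) * y k l (z n).
  apply: (eq_at_right_lim (z_incr nN') (wronskian_constant
    (distance_solves (leq0n _) nN') (jacobi_solves k l nN')) _ xn').
  apply: cvgB; apply: cvgM.
  - exact: cvg_at_right_filter.
  - exact: (matrix_entry_cvg (i := k) (j := l) (cvg_comp _ _
      (affine_parameter_cvg_right c_gt0 H0_gt0 Omega_ge0 (ltW zn0)) Jpl)).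
  - exact: cvg_at_right_filter.
  - exact: jacobi_entry_cvg_right.
have eqJkl : Jp k l - Jm k l = - ((1 + z n) * (Ut n *m J (lambda (z n))) k l).
  by have := congr1 (fun M : 'M[R]_2 => M k l) eqJ; rewrite !mxE.
rewrite Wp Wm; transitivity (d (z n) * (Jp k l - Jm k l)); first by ring.
by rewrite eqJkl; ring.
Qed.

(** Written with [r] instead of the distances: [c / H0] cancels in every ratio and survives only in
    front of [Ut n]. *)
Lemma jacobi_entry_recurrence n k l : (1 <= n <= N)%N ->
  y k l (z n.+1) =
    - (c / H0 * r (z n) (z n.+1) * (Ut n *m J (lambda (z n))) k l)
    - (1 + z n.-1) / (1 + z n) * (r (z n) (z n.+1) / r (z n.-1) (z n))
      * y k l (z n.-1)
    + ((1 + z n.-1) / (1 + z n)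
       * (r (z n) (z n.+1) * d (z n.-1) / (r (z n.-1) (z n) * d (z n)))
       + d (z n.+1) / d (z n)) * y k l (z n).
Proof.
move=> /[dup] nN /andP[n1 nN'].
have n1N : (n.-1 <= N)%N := leq_trans (leq_pred n) nN'.
have zltm : z n.-1 < z n by rewrite -{2}(prednK n1) z_incr.
have zltp := z_incr nN'.
(* Midpoints serve as sample points; the Wronskian is constant on each segment. *)
pose x := (z n.-1 + z n) / 2; pose x' := (z n + z n.+1) / 2.
have xn : z n.-1 < x < z n by rewrite /x; apply/andP; split; lra.
have xn' : z n < x' < z n.+1 by rewrite /x'; apply/andP; split; lra.
have jump := wronskian_jump k l nN xn xn'.
have segp := wronskian_segment k l nN' xn'.
have segm := @wronskian_segment n.-1 k l x n1N; rewrite prednK// in segm.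
have {segm} segm := segm xn.
have rp : 0 < r (z n) (z n.+1) by exact: distance_pos.
have rm : 0 < r (z n.-1) (z n) by rewrite distance_pos// ?prednK// leqW.
have dn : 0 < d (z n) by rewrite distance_pos// leqW.
have zn1 : 0 < 1 + z n by rewrite one_plus_redshift_gt0// redshift_ge0// leqW.
move: jump segp segm; set W' := wronskian _ _ _ _ x'; set W := wronskian _ _ _ _ x.
set u := (_ *m _) k l.
move=> jump segp segm.
have W'E : W' = W - d (z n) * (1 + z n) * u by rewrite -jump; ring.
have WE : W = H0 / c * (1 + z n.-1) *
    (y k l (z n) * d (z n.-1) - d (z n) * y k l (z n.-1)) / r (z n.-1) (z n).
  by rewrite -segm; field; rewrite gt_eqF.
(* The identity of the right segment is solved for the next value; dividing by [d (z n)] is allowed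
   since [n >= 1]. *)
have yE : y k l (z n.+1) = (r (z n) (z n.+1) * W' / (H0 / c * (1 + z n))
    + d (z n.+1) * y k l (z n)) / d (z n).
  by rewrite segp; field; rewrite !gt_eqF.
by rewrite yE W'E WE; field; rewrite !gt_eqF.
Qed.

(** On the first segment the Wronskian with [d] is 0, as [y] and [d] both vanish at [z 0]. Hence
    [y / d] is constant, equal to the ratio of the initial slopes. *)
Lemma jacobi_first_plane k l :
  y k l (z 1%N) = c / H0 * d (z 1%N) * (k == l)%:R.
Proof.
have zlt := z_incr (leq0n N).
have z1N : (1 <= 1 <= N.+1)%N by [].
have z1_gt0 := redshift_gt0 z1N.
have dpos x : z 0%N < x -> 0 < d x.
  exact: (dyer_roeder_pos c_gt0 H0_gt0 Omega_ge0 alpha_le1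
    (redshift_ge0 (leq0n _)) (r_sol (leq0n _))).
have W0 x : z 0%N < x < z 1%N -> wronskian d D (y k l) (Y k l) x = 0.
  move=> xi; have := wronskian_segment k l (leq0n N) xi.
  rewrite distance0 jacobi0 !mulr0 subrr mulr0 => /eqP.
  by rewrite mulf_eq0 gt_eqF ?distance_pos// => /eqP.
pose q x := y k l x / d x.
have dq x : z 0%N < x < z 1%N -> is_derive x 1 q 0.
  move=> xi; have [dy _] := jacobi_solves k l (leq0n N) xi.
  have [dd _] := distance_solves (leq0n N.+1) (leq0n N) xi.
  have dx : 0 < d x by apply: dpos; case/andP: xi.
  have dN0 : d x != 0 by rewrite gt_eqF.
  have dV := is_deriveV dN0 dd.
  rewrite /q; apply: is_derive_eq; rewrite -![_ *: _]/(_ * _).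
  transitivity (phi x / d x ^+ 2 * wronskian d D (y k l) (Y k l) x).
    by rewrite /wronskian /D; field.
  by rewrite W0// mulr0.
have q0 : q t @[t --> (z 0%N)^'+] --> c / H0 * (k == l)%:R.
  rewrite z0.
  have lcvg := affine_parameter_cvg_right c_gt0 H0_gt0 Omega_ge0 (lexx 0).
  rewrite affine_parameter0 in lcvg.
  case: J_sol => _ J0 J1 _ _.
  have H1 := matrix_entry_cvg (i := k) (j := l) (cvg_comp _ _ lcvg J1).
  have H2 := affine_parameter_slope0 c_gt0 H0_gt0 Omega_ge0.
  have [_ _ H3] := r_sol (leq0n N.+1).
  have s1 : Num.sqrt (Omega * 0 + 1) = 1 by rewrite mulr0 add0r sqrtr1.
  rewrite /has_right_derivative z0 addr0 expr1n mul1r s1 invr1 in H3.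
  (* Near 0, [y / d] is the difference quotient of [J] in the affine parameter, times that of
     [lambda], divided by that of [r 0]. *)
  have H : (fun t => ((lambda t)^-1 *: (J (0 + lambda t) - J 0)) k l
      * (lambda t / t) * (t^-1 *: (r 0 (0 + t) - r 0 0))^-1) t @[t --> 0^'+] -->
      (1%:M : 'M[R]_2) k l * dlambda c H0 Omega 0 * 1^-1.
    apply: cvgM; first by apply: cvgM; [exact: H1|exact: H2].
    by apply: cvgV; [exact: oner_neq0|exact: H3].
  have -> : c / H0 * (k == l)%:R = (1%:M : 'M[R]_2) k l * dlambda c H0 Omega 0 * 1^-1.
    by rewrite mxE /dlambda /hubble s1 addr0 expr1n !mul1r invr1 !mulr1 mulrC.
  apply: cvg_trans H; apply: near_eq_cvg; near=> t.
  have t0 : 0 < t by [].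
  have lt0 : 0 < lambda t.
    by rewrite -(affine_parameter0 c H0 Omega) affine_parameter_lt.
  have d0 : r 0 0 = 0 by have := distance0; rewrite /d z0.
  have dt : 0 < r 0 t by have := dpos t; rewrite /d z0; apply.
  rewrite !add0r J0 d0 !subr0 mxE -![_ *: _]/(_ * _) /q /y /d z0.
  by field; rewrite !gt_eqF.
have q1 : q t @[t --> (z 1%N)^'-] --> y k l (z 1%N) / d (z 1%N).
  apply: cvgM; first exact: jacobi_entry_cvg_left.
  apply: cvgV; first by rewrite gt_eqF// dpos.
  by apply: cvg_at_left_filter; apply: distance_continuous.
have mid : z 0%N < (z 0%N + z 1%N) / 2 < z 1%N by apply/andP; split; lra.
have e0 := eq_at_right_lim zlt (constant_oo dq) q0 mid.
have e1 := eq_at_left_lim zlt (constant_oo dq) q1 mid.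
have dN : d (z 1%N) != 0 by rewrite gt_eqF// dpos.
by rewrite mulrAC -e0 e1 divfK.
Unshelve. all: by end_near. Qed.

End multiple_lens_planes.

(** * The matrix recurrence and its dimensionless form *)

Theorem mainTheorem7 (R : realType) (c H0 Omega alpha : R) (N : nat)
  (z : nat -> R) (r : R -> R -> R) (Ut : nat -> 'M[R]_2) (J : R -> 'M[R]_2)
  (c_gt0 : 0 < c) (H0_gt0 : 0 < H0) (Omega_ge0 : 0 <= Omega)
  (alpha_01 : 0 <= alpha <= 1) (N_ge1 : (1 <= N)%N)
  (z0 : z 0%N = 0) (z_incr : forall i : nat, (i <= N)%N -> z i < z i.+1)
  (r_sol : forall i : nat, (i <= N.+1)%N -> dyer_roeder_from Omega alpha r (z i))
  (Ut_sym : forall i : nat, (1 <= i <= N)%N -> (Ut i)^T = Ut i)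
  (J_sol : jacobi_solution c H0 Omega alpha N z Ut J) :
  let D (i j : nat) : R := angular_distance c H0 r (z i) (z j) in
  let Jn (n : nat) : 'M[R]_2 := J (affine_parameter c H0 Omega (z n)) in
  let v := lens_v c z D in
  let beta := lens_beta N D in
  let U := lens_U N D Ut in
  (forall n : nat, (1 <= n <= N)%N ->
     Jn n.+1 =
       - (D n n.+1 *: (Ut n *m Jn n))
       - ((1 + z n.-1) / (1 + z n) * (D n n.+1 / D n.-1 n)) *: Jn n.-1
       + ((1 + z n.-1) / (1 + z n) * (D n n.+1 * D 0%N n.-1 / (D n.-1 n * D 0%N n))
          + D 0%N n.+1 / D 0%N n) *: Jn n)
  /\
  (* the value A 0 is left unconstrained *)
  (forall A : nat -> 'M[R]_2,
     (forall n : nat, (1 <= n <= N.+1)%N -> A n = (D 0%N n)^-1 *: Jn n) ->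
     [/\ A 1%N = 1%:M,
         v 1%N = 0 &
         forall n : nat, (1 <= n <= N)%N ->
           A n.+1 = (1 + v n ^+ 2) *: A n - v n ^+ 2 *: A n.-1
                    - beta n n.+1 *: (U n *m A n)]).
Proof.
move=> D Jn v beta U; have /andP[_ alpha_le1] := alpha_01.
have rpos i j : (i < j)%N -> (j <= N.+1)%N -> 0 < r (z i) (z j).
  exact: distance_pos c_gt0 H0_gt0 Omega_ge0 alpha_le1 z0 z_incr r_sol i j.
have DE i j : (i < j)%N -> (j <= N.+1)%N -> D i j = c / H0 * r (z i) (z j).
  by move=> ij jN; rewrite /D /angular_distance gtr0_norm// rpos.
have Dpos i j : (i < j)%N -> (j <= N.+1)%N -> 0 < D i j.
  by move=> ij jN; rewrite DE// mulr_gt0 ?rpos ?divr_gt0.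
have D00 : D 0%N 0%N = 0.
  rewrite /D /angular_distance; case: (r_sol 0%N (leq0n _)) => _ -> _.
  by rewrite normr0 mulr0.
(* The index [i = 0], where both sides vanish, is included for the term [D 0 n.-1] at [n = 1]. *)
have D0E i : (i <= N.+1)%N -> D 0%N i = c / H0 * r (z 0%N) (z i).
  case: i => [_|i iN]; last exact: DE.
  by rewrite D00; case: (r_sol 0%N (leq0n _)) => _ -> _; rewrite mulr0.
have zpos i : (i <= N.+1)%N -> 0 < 1 + z i.
  move=> iN; rewrite one_plus_redshift_gt0//; exact: redshift_ge0 z0 z_incr i iN.
have Jrec n : (1 <= n <= N)%N -> Jn n.+1 =
       - (D n n.+1 *: (Ut n *m Jn n))
       - ((1 + z n.-1) / (1 + z n) * (D n n.+1 / D n.-1 n)) *: Jn n.-1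
       + ((1 + z n.-1) / (1 + z n) * (D n n.+1 * D 0%N n.-1 / (D n.-1 n * D 0%N n))
          + D 0%N n.+1 / D 0%N n) *: Jn n.
  move=> /[dup] nN /andP[n1 nN'].
  have nN1 := leqW nN'.
  have predn_lt : (n.-1 < n)%N by rewrite prednK.
  have rn := rpos _ _ (ltnSn n) nN'; have rm := rpos _ _ predn_lt nN1.
  have dn := rpos _ _ n1 nN1; have zn := zpos n nN1.
  apply/matrixP => k l; rewrite /Jn.
  rewrite (jacobi_entry_recurrence c_gt0 H0_gt0 Omega_ge0 alpha_le1 z0 z_incr
    r_sol J_sol k l nN).
  rewrite !(DE n n.+1)// !(DE n.-1 n)// !D0E// ?(leq_trans (leq_pred n))//.
  rewrite [RHS]mxE [in RHS]mxE [in RHS]mxE.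
  set u := (_ *m _); rewrite !mxE.
  by field; rewrite !gt_eqF.
split=> // A AE.
have thpos i : (1 <= i <= N)%N -> 0 < vartheta c z D i.
  move=> /andP[i1 iN]; rewrite /vartheta mulr_gt0//.
    by rewrite divr_gt0// zpos// leqW.
  have D0i : 0 < D 0%N i by apply: Dpos => //; exact: leqW.
  have D0i1 : 0 < D 0%N i.+1 by exact: Dpos.
  by apply: divr_gt0; [exact: mulr_gt0|exact: Dpos].
have th0 : vartheta c z D 0 = 0 by rewrite /vartheta D00 mul0r mul0r mulr0.
have v1 : v 1%N = 0 by rewrite /v /lens_v th0 mul0r sqrtr0 oppr0.
split=> //.
- rewrite AE//; apply/matrixP => k l; rewrite !mxE /Jn.
  rewrite (jacobi_first_plane c_gt0 H0_gt0 Omega_ge0 alpha_le1 z0 z_incr r_sol J_sol).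
  by rewrite DE// mulrA mulVf ?mul1r// gt_eqF// mulr_gt0 ?rpos ?divr_gt0.
- move=> n /[dup] nN /andP[n1 nN'].
  have nN1 := leqW nN'.
  have predn_lt : (n.-1 < n)%N by rewrite prednK.
  (* The factors [c] and [D 0 n] cancel in the quotient of consecutive [vartheta]; at [n = 1] both
     sides are 0. *)
  have v2 : v n ^+ 2 = (1 + z n.-1) / (1 + z n) *
      (D 0%N n.-1 * D n n.+1 / (D n.-1 n * D 0%N n.+1)).
    have th_ge0 : 0 <= vartheta c z D n.-1 / vartheta c z D n.
      rewrite divr_ge0 ?(ltW (thpos n nN))//.
      case: n {n1 nN1 predn_lt} nN nN' => [//|[|n]] nN nN' /=; first by rewrite th0.
      by rewrite ltW// thpos//= ltnW.
    rewrite /v /lens_v sqrrN sqr_sqrtr// /vartheta prednK//.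
    have Dn := Dpos _ _ n1 nN1; have Dn1 := Dpos 0%N n.+1 (ltn0Sn n) nN'.
    have Dm := Dpos _ _ predn_lt nN1; have Dp := Dpos _ _ (ltnSn n) nN'.
    have zn := zpos n nN1.
    by field; rewrite !gt_eqF.
  (* The distances to the source plane [N.+1] cancel between [beta] and [U], and [D 0 n] cancels
     against the denominator of [A n]. *)
  have bU : beta n n.+1 *: (U n *m A n) = (D n n.+1 / D 0%N n.+1) *: (Ut n *m Jn n).
    have Dn := Dpos _ _ n1 nN1; have Dn1 := Dpos 0%N n.+1 (ltn0Sn n) nN'.
    have DnN := Dpos n N.+1 nN' (leqnn _); have DN := Dpos 0%N N.+1 (ltn0Sn _) (leqnn _).
    rewrite AE ?n1// /beta /U /lens_beta /lens_U -scalemxAl -scalemxAr !scalerA.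
    by congr (_ *: _); field; rewrite !gt_eqF.
  (* The factor [D 0 n.-1] is cancelled on the right. For [n = 1], where [A 0] is arbitrary, the
     left side is 0 by [v 1 = 0] and the right side by [J 0 = 0]. *)
  have vA : v n ^+ 2 *: A n.-1 =
      ((1 + z n.-1) / (1 + z n) * (D n n.+1 / (D n.-1 n * D 0%N n.+1))) *: Jn n.-1.
    case: n {bU v2} nN n1 nN' nN1 predn_lt v2 => [//|[|n]] nN n1 nN' nN1 nn v2 /=.
      rewrite v1 expr0n scale0r /Jn z0 affine_parameter0.
      by case: J_sol => _ -> _ _ _; rewrite scaler0.
    rewrite v2 /= AE ?scalerA; last by rewrite /= leqW// ltnW.
    congr (_ *: _).
    have Dn := Dpos 0%N n.+1 (ltn0Sn n) (leqW (ltnW nN')).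
    have Dn1 := Dpos 0%N n.+3 (ltn0Sn _) nN'.
    have Dm := Dpos _ _ nn nN1; have zn := zpos n.+2 nN1.
    by field; rewrite !gt_eqF.
  (* What remains is the first recurrence divided by [D 0 n.+1]. *)
  rewrite bU vA v2 AE// AE ?n1// Jrec//.
  have Dn := Dpos _ _ n1 nN1; have Dn1 := Dpos 0%N n.+1 (ltn0Sn n) nN'.
  have Dm := Dpos _ _ predn_lt nN1; have zn := zpos n nN1.
  apply/matrixP => k l; set M := (_ *m _); rewrite !mxE.
  by field; rewrite !gt_eqF.
Qed.
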